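(* Let $m\ge 1$ and let $w_1,w_2\in \mathbf{F}_m$ be two elements whose nontrivial powers are all distinct (i.e. the elements $w_1^{a}$, $a\in\mathbb{Z}\setminus\{0\}$, and $w_2^{b}$, $b\in\mathbb{Z}\setminus\{0\}$, are pairwise distinct). Then for every $R>0$ there is a constant $C$, depending only on $w_1,w_2,R$ and $m$, such that for every integer $n\ge 1$ $$\frac{\left|\{\phi\in \operatorname{Hom}_{m,n} : w_1,w_2 \text{ are } R\text{-tangled by } \phi\}\right|}{\left|\operatorname{Hom}_{m,n}\right|}\le \frac{C}{n}.$$
   Context: $\mathbf{F}_m$ is the free group on $m$ generators, $\mathbf{S}_n$ is the symmetric group of permutations of $[n]=\{1,\dots,n\}$, and $\operatorname{Hom}_{m,n}$ is the (finite) set of homomorphisms $\mathbf{F}_m\to\mathbf{S}_n$. For $R>0$, elements $w_1,w_2\in\mathbf{F}_m$ are $R$-tangled by $\phi\in\operatorname{Hom}_{m,n}$ if there exists $k\in[n]$ such that $$|\operatorname{Orb}(\phi(w_1),k)|+|\operatorname{Orb}(\phi(w_2),k)|\le R,$$ where $\operatorname{Orb}(\phi(w_i),k)\subset[n]$ is the orbit of $k$ under the iterates of the permutation $\phi(w_i)$. *)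

(* Defs.v *)
From HB Require Import structures.
From mathcomp Require Import all_boot all_order all_fingroup all_algebra.
From mathcomp Require Import boolp reals.

Set Implicit Arguments.
Unset Strict Implicit.
Unset Printing Implicit Defensive.

Import Order.TTheory GRing.Theory Num.Theory.

(* The letter (i, false) stands for the generator x_i, and (i, true) for its
   inverse. *)
Definition letter (m : nat) : Type := ('I_m * bool)%type.
HB.instance Definition _ m := Finite.on (letter m).

Definition linv m (a : letter m) : letter m := (a.1, ~~ a.2).

Lemma linvK m : involutive (@linv m).
Proof. by case=> i b; rewrite /linv /= negbK. Qed.

Definition reduced m (s : seq (letter m)) : bool :=
  sorted (fun a b => b != linv a) s.

Definition lcons m (a : letter m) (s : seq (letter m)) : seq (letter m) :=
  if s is b :: s' then if b == linv a then s' else a :: s else [:: a].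

Definition reduce m (s : seq (letter m)) : seq (letter m) :=
  foldr (@lcons m) [::] s.

Definition winv m (s : seq (letter m)) : seq (letter m) :=
  rev (map (@linv m) s).

Section ReducedWords.
Variable m : nat.
Implicit Types (a b : letter m) (s t u : seq (letter m)).

Lemma reduced_lcons a s : reduced s -> reduced (lcons a s).
Proof.
case: s => [|b s] //= Hs; case: (boolP (b == linv a)) => [_|nba].
  exact: path_sorted Hs.
by rewrite /reduced /= nba.
Qed.

Lemma lconsK a s : reduced s -> lcons (linv a) (lcons a s) = s.
Proof.
case: s => [|b s] //= => [_|]; first by rewrite linvK eqxx.
case: (altP (b =P linv a)) => [-> | nba] /=; last by rewrite linvK eqxx.
by case: s => [|c s] //= /andP[/negbTE ->].
Qed.

Lemma reduced_foldr s t : reduced t -> reduced (foldr (@lcons m) t s).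
Proof. by move=> rt; elim: s => //= a s; exact: reduced_lcons. Qed.

Lemma reduced_reduce s : reduced (reduce s).
Proof. exact: reduced_foldr. Qed.

Lemma reduce_id s : reduced s -> reduce s = s.
Proof.
elim: s => [|a s IHs] //= ras; rewrite IHs; last exact: path_sorted ras.
by case: s ras {IHs} => [|b s] //= /andP[/negbTE ->].
Qed.

Lemma foldr_lcons a s t : reduced t ->
  foldr (@lcons m) t (lcons a s) = lcons a (foldr (@lcons m) t s).
Proof.
move=> rt; case: s => [|b s] //=; case: eqP => [-> |//].
by rewrite -{1}[a]linvK lconsK //; exact: reduced_foldr.
Qed.

Lemma foldr_reduce s t : reduced t ->
  foldr (@lcons m) t (reduce s) = foldr (@lcons m) t s.
Proof. by move=> rt; elim: s => //= a s IHs; rewrite foldr_lcons // IHs. Qed.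

Lemma reduce_cat s t : reduce (s ++ t) = foldr (@lcons m) (reduce t) s.
Proof. by rewrite /reduce foldr_cat. Qed.

Lemma reduce_catl s t : reduce (reduce s ++ t) = reduce (s ++ t).
Proof. by rewrite !reduce_cat foldr_reduce // reduced_reduce. Qed.

Lemma reduce_catr s t : reduce (s ++ reduce t) = reduce (s ++ t).
Proof. by rewrite !reduce_cat (reduce_id (reduced_reduce t)). Qed.

Lemma winvK : involutive (@winv m).
Proof. by move=> s; rewrite /winv map_rev revK (mapK (@linvK m)). Qed.

Lemma reduced_winv s : reduced s -> reduced (winv s).
Proof.
rewrite /reduced /winv rev_sorted sorted_map; apply: sub_sorted => a b /=.
by rewrite linvK eq_sym -(inj_eq (can_inj (@linvK m))) linvK eq_sym.
Qed.

Lemma reduce_winvl s : reduce (winv s ++ s) = [::].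
Proof.
elim: s => [|a s IHs] //; rewrite /winv /= rev_cons cat_rcons.
rewrite reduce_cat /= lconsK ?reduced_reduce //.
by rewrite -reduce_cat.
Qed.

End ReducedWords.

Record free_group (m : nat) : Type := FreeGroup {
  fgval :> seq (letter m);
  fgvalP : reduced fgval
}.
HB.instance Definition _ m := [isSub for @fgval m].
HB.instance Definition _ m := [Choice of free_group m by <:].

Section FreeGroupLaw.
Variable m : nat.
Implicit Types x y z : free_group m.

Definition fg_of (s : seq (letter m)) : free_group m :=
  FreeGroup (reduced_reduce s).
Definition fg_one : free_group m := @FreeGroup m [::] isT.
Definition fg_inv x : free_group m := FreeGroup (reduced_winv (fgvalP x)).
Definition fg_mul x y : free_group m := fg_of (x ++ y).

Lemma fg_mulA : associative fg_mul.
Proof.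
by move=> x y z; apply: val_inj; rewrite /= reduce_catl reduce_catr catA.
Qed.

Lemma fg_mul1 : left_id fg_one fg_mul.
Proof. by move=> x; apply: val_inj; rewrite /= reduce_id ?fgvalP. Qed.

Lemma fg_mulr1 : right_id fg_one fg_mul.
Proof. by move=> x; apply: val_inj; rewrite /= cats0 reduce_id ?fgvalP. Qed.

Lemma fg_mulV : left_inverse fg_one fg_inv fg_mul.
Proof. by move=> x; apply: val_inj; rewrite /= reduce_winvl. Qed.

Lemma fg_mulrV : right_inverse fg_one fg_inv fg_mul.
Proof.
by move=> x; apply: val_inj; rewrite /= -{1}[fgval x]winvK reduce_winvl.
Qed.

HB.instance Definition _ := isGroup.Build (free_group m)
  fg_mulA fg_mul1 fg_mulr1 fg_mulV fg_mulrV.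

Definition fg_gen (i : 'I_m) : free_group m := @FreeGroup m [:: (i, false)] isT.

End FreeGroupLaw.

(* The product of 'S_n composes permutations from left to right. This is the
   opposite of the usual convention, but inversion is an isomorphism between
   the two group laws, and a permutation and its inverse have the same orbits. *)
Definition HomFS (m n : nat) : Type := UMagmaMorphism.type (free_group m) 'S_n.

(* A homomorphism is determined by arbitrary images of the generators, which
   makes HomFS m n a finite type. *)
Section HomFinite.
Variables m n : nat.
Local Open Scope group_scope.

Definition letter_val (f : {ffun 'I_m -> 'S_n}) (a : letter m) : 'S_n :=
  if a.2 then (f a.1)^-1 else f a.1.

Definition word_val f (s : seq (letter m)) : 'S_n :=
  \prod_(a <- s) letter_val f a.

Lemma letter_valV f a : letter_val f (linv a) = (letter_val f a)^-1.
Proof. by case: a => i []; rewrite /letter_val /= ?invgK. Qed.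

Lemma word_val_reduce f s : word_val f (reduce s) = word_val f s.
Proof.
elim: s => // a s IHs; rewrite [RHS]/word_val big_cons -/(word_val f s) -IHs /=.
case: (reduce s) => [|b t] /=; first by rewrite /word_val big_seq1 big_nil mulg1.
case: eqP => [-> |_]; rewrite /word_val !big_cons //.
by rewrite letter_valV mulKVg.
Qed.

Definition fg_eval f (x : free_group m) : 'S_n := word_val f x.

Lemma fg_eval_monoid f : monoid.monoid_morphism (fg_eval f).
Proof.
split=> [|x y]; first by rewrite /fg_eval /word_val big_nil.
by rewrite /fg_eval /= word_val_reduce /word_val big_cat.
Qed.

HB.instance Definition _ f :=
  isUMagmaMorphism.Build (free_group m) 'S_n (fg_eval f) (fg_eval_monoid f).

Definition hom_of (f : {ffun 'I_m -> 'S_n}) : HomFS m n := fg_eval f.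

Definition gens_of (phi : HomFS m n) : {ffun 'I_m -> 'S_n} :=
  [ffun i => phi (fg_gen i)].

Lemma fg_evalE (phi : HomFS m n) x : fg_eval (gens_of phi) x = phi x.
Proof.
case: x => s; rewrite /fg_eval /=; elim: s => [|a s IHs] rs.
  rewrite /word_val big_nil (_ : FreeGroup rs = 1) ?gmulf1 //.
  exact: val_inj.
have rs' : reduced s := path_sorted rs.
rewrite /word_val big_cons -/(word_val _ s) (IHs rs').
have ra : reduced [:: a] by [].
have -> : FreeGroup rs = FreeGroup ra * FreeGroup rs'.
  by apply: val_inj; rewrite -[LHS](reduce_id rs).
rewrite gmulfM; congr (_ * _); rewrite /letter_val ffunE.
case: a {rs IHs} ra => i [] ra /=; last by congr (phi _); apply: val_inj.
by rewrite -gmulfV; congr (phi _); apply: val_inj.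
Qed.

Lemma HomFS_eq (phi psi : HomFS m n) : phi =1 psi -> phi = psi.
Proof.
case: phi => f [[f1] [fM]]; case: psi => g [[g1] [gM]] /= fg.
have {}fg : f = g by apply/funext.
case: _ / fg in g1 gM *.
by rewrite (Prop_irrelevance f1 g1) (Prop_irrelevance fM gM).
Qed.

Lemma gens_ofK : cancel gens_of hom_of.
Proof. by move=> phi; apply: HomFS_eq => x; exact: fg_evalE. Qed.

Lemma hom_ofK : cancel hom_of gens_of.
Proof.
by move=> f; apply/ffunP=> i; rewrite ffunE /= /fg_eval /word_val big_seq1.
Qed.

HB.instance Definition _ := Finite.copy (HomFS m n) (can_type gens_ofK).

Lemma card_HomFS : #|{: HomFS m n}| = (n`! ^ m)%N.
Proof.
rewrite (bij_eq_card (Bijective gens_ofK hom_ofK)) card_ffun card_ord.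
by rewrite card_Sn.
Qed.

End HomFinite.

Local Open Scope ring_scope.

Definition zexpg (G : groupType) (x : G) (a : int) : G :=
  match a with Posz k => x ^+ k | Negz k => x ^- k.+1 end%g.

Definition distinct_powers (G : groupType) (w1 w2 : G) : Prop :=
  [/\ forall a b : int, a != 0 -> b != 0 -> zexpg w1 a = zexpg w1 b -> a = b,
      forall a b : int, a != 0 -> b != 0 -> zexpg w2 a = zexpg w2 b -> a = b
    & forall a b : int, a != 0 -> b != 0 -> zexpg w1 a <> zexpg w2 b].

Definition tangled (K : realType) (R : K) (m n : nat) (w1 w2 : free_group m)
    (phi : HomFS m n) : bool :=
  [exists k : 'I_n,
    (#|porbit (phi w1) k| + #|porbit (phi w2) k|)%N%:R <= R].

(* Main.v *)
(* If phi tangles w1 and w2 at k, then u = w1^a and v = w2^b with 1 <= a, b <= R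
   both fix k.  Follow the closed walk spelled by uv from k in the Schreier graph
   of phi, and let V and E be the numbers of vertices and edges it visits.  If
   E <= V, the visited subgraph has at most one edge outside a spanning tree, so
   its fundamental group is cyclic and u, v are powers of one element, which the
   hypothesis on w1, w2 forbids; hence E >= V + 1.  There are O(n^V) walks of
   given length visiting V vertices, and a uniformly random phi contains E
   prescribed edges with probability O(n^-E), so that the probability of finding
   such a k is O(1/n). *)
Require Import Defs.
From mathcomp Require Import all_boot all_order all_fingroup all_algebra.
From mathcomp Require Import reals.

Set Implicit Arguments.
Unset Strict Implicit.
Unset Printing Implicit Defensive.

Import Order.TTheory GRing.Theory Num.Theory.

Local Open Scope group_scope.

(** * Powers of a common group element *)

Section PlusMinusPowers.
Variable G : groupType.
Implicit Types (g x y : G).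

Definition pm_power g x := exists n, x = g ^+ n \/ x = g ^- n.

Lemma pm_power1 g : pm_power g 1.
Proof. by exists 0%N; left. Qed.

Lemma pm_power_mulgl g x : pm_power g x -> pm_power g (g * x).
Proof.
case=> n [->|->]; first by exists n.+1; left; rewrite expgS.
case: n => [|n]; first by exists 1%N; left; rewrite expg0 invg1 mulg1.
by exists n; right; rewrite expgSr invgM mulKVg.
Qed.

Lemma pm_powerV g x : pm_power g^-1 x -> pm_power g x.
Proof.
by case=> n [->|->]; exists n; [right | left]; rewrite expVgn // invgK.
Qed.

Lemma pm_power_mulVgl g x : pm_power g x -> pm_power g (g^-1 * x).
Proof.
move=> gx; apply/pm_powerV/pm_power_mulgl; case: gx => n [->|->]; exists n.
  by right; rewrite expVgn invgK.
by left; rewrite expVgn.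
Qed.

(** If [x] and [y] are [g] to the powers [±p] and [±q], then [x ^+ q] and [y ^+ p] are both [g] to
    the power [±pq]. The two implications let nontriviality of [x] and [y] force positive
    exponents. *)
Lemma pm_power_commensurable g x y : pm_power g x -> pm_power g y ->
  exists p q, [/\ p = 0%N -> x = 1, q = 0%N -> y = 1
    & x ^+ q = y ^+ p \/ x ^+ q = y ^- p].
Proof.
move=> [p xE] [q yE]; exists p, q; split.
- by move=> p0; case: xE => ->; rewrite p0 ?expg0 ?invg1.
- by move=> q0; case: yE => ->; rewrite q0 ?expg0 ?invg1.
have E : (g ^+ p) ^+ q = (g ^+ q) ^+ p by rewrite -!expgnA mulnC.
by case: xE => ->; case: yE => ->; rewrite ?expVgn ?invgK E; [left|right|right|left].
Qed.

Lemma zexpg_negn x n : zexpg x (- Posz n)%R = x ^- n.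
Proof. by case: n => [|n] //=; rewrite ?oppr0 /= ?expg0 ?invg1. Qed.

(** A trivial [n]-th power would coincide with the [2n]-th power. *)
Lemma distinct_powers_neq1 x y n : distinct_powers x y -> (0 < n)%N ->
  x ^+ n <> 1 /\ y ^+ n <> 1.
Proof.
case=> Hx Hy _; case: n => // n _.
have neq : (n.+1 == n.+1 * 2)%N = false by rewrite -{1}[n.+1]muln1 eqn_pmul2l.
split=> E; [have := Hx n.+1 (n.+1 * 2)%N isT isT
  | have := Hy n.+1 (n.+1 * 2)%N isT isT].
  by rewrite /= expgnA E expg1n => /(_ erefl) /eqP; rewrite eqz_nat neq.
by rewrite /= expgnA E expg1n => /(_ erefl) /eqP; rewrite eqz_nat neq.
Qed.

(** Two powers of one [g] are commensurable, so some nonzero power of [x] would equal a nonzero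
    power of [y]. *)
Lemma distinct_powers_no_root x y a b g : distinct_powers x y ->
  (0 < a)%N -> (0 < b)%N -> pm_power g (x ^+ a) -> pm_power g (y ^+ b) -> False.
Proof.
move=> dxy a0 b0 gx gy.
have [p [q [p0 q0 E]]] := pm_power_commensurable gx gy.
have [xa _] := distinct_powers_neq1 dxy a0.
have [_ yb] := distinct_powers_neq1 dxy b0.
have {p0}p0 : (0 < p)%N by rewrite lt0n; apply/eqP => /p0.
have {q0}q0 : (0 < q)%N by rewrite lt0n; apply/eqP => /q0.
case: dxy => _ _ dxy.
have aq : (a * q)%N != 0 by rewrite muln_eq0 negb_or -!lt0n a0.
have bp : (b * p)%N != 0 by rewrite muln_eq0 negb_or -!lt0n b0.
rewrite -!expgnA in E; case: E => E.
  exact: (dxy (a * q)%N (b * p)%N aq bp).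
by apply: (dxy (a * q)%N (- Posz (b * p))%R aq);
  rewrite ?oppr_eq0 ?zexpg_negn.
Qed.

End PlusMinusPowers.

(** * Words and their walks in the Schreier graph *)

Lemma fg_of_cat m (s t : seq (letter m)) : fg_of (s ++ t) = fg_of s * fg_of t.
Proof. by apply: val_inj; rewrite /= reduce_catl reduce_catr. Qed.

Lemma fg_ofK m (x : free_group m) : fg_of x = x.
Proof. by apply: val_inj; rewrite /= reduce_id ?fgvalP. Qed.

Lemma fg_of_letter m (a : letter m) :
  fg_of [:: a] = if a.2 then (fg_gen a.1)^-1 else fg_gen a.1.
Proof. by case: a => i []; apply: val_inj. Qed.

Section Walks.
Variables m n : nat.
Implicit Types (f : {ffun 'I_m -> 'S_n}) (k x y : 'I_n) (a : letter m).
Implicit Types (s : seq (letter m)) (e : 'I_m * 'I_n).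

(* The i-labelled edge of the Schreier graph of f from y to f i y is encoded as
   (i, y); a letter (i, true) runs through an edge backwards. *)
Definition step_edge f y a : 'I_m * 'I_n :=
  (a.1, if a.2 then letter_val f a y else y).

Fixpoint walk f k s : seq 'I_n :=
  k :: (if s is a :: s' then walk f (letter_val f a k) s' else [::]).

Fixpoint walk_edges f k s : seq ('I_m * 'I_n) :=
  if s is a :: s' then step_edge f k a :: walk_edges f (letter_val f a k) s'
  else [::].

Definition vset f k s := [set x in walk f k s].
Definition eset f k s := [set e in walk_edges f k s].

Lemma size_walk f k s : size (walk f k s) = (size s).+1.
Proof. by elim: s k => //= a s IHs k; rewrite IHs. Qed.

Lemma size_walk_edges f k s : size (walk_edges f k s) = size s.
Proof. by elim: s k => //= a s IHs k; rewrite IHs. Qed.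

Lemma word_val_cons f a s x :
  word_val f (a :: s) x = word_val f s (letter_val f a x).
Proof. by rewrite /word_val big_cons permM. Qed.

Lemma walk_edges_cat f k s t :
  walk_edges f k (s ++ t) = walk_edges f k s ++ walk_edges f (word_val f s k) t.
Proof.
elim: s k => [|a s IHs] k /=; first by rewrite /word_val big_nil perm1.
by rewrite IHs word_val_cons.
Qed.

(* With t x the word of the tree path from the base point to x, this is the
   element of the fundamental group carried by the edge e. *)
Definition gap f (t : 'I_n -> free_group m) e : free_group m :=
  t e.2 * fg_gen e.1 * (t (f e.1 e.2))^-1.

Lemma gap_step f t k a : t k * fg_of [:: a] * (t (letter_val f a k))^-1 =
  if a.2 then (gap f t (step_edge f k a))^-1 else gap f t (step_edge f k a).
Proof.
rewrite fg_of_letter /gap /step_edge /letter_val; case: a => i [] //=.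
by rewrite permKV !invgM invgK mulgA.
Qed.

(** Inserting tree words between consecutive letters turns the product into a telescoping product of
    gaps and inverses of gaps, each of them 1, [g] or the inverse of [g]. *)
Lemma walk_pm_power f t g k s :
  {in walk_edges f k s, forall e, gap f t e = 1 \/ gap f t e = g} ->
  pm_power g (t k * fg_of s * (t (word_val f s k))^-1).
Proof.
elim: s k => [|a s IHs] k tg /=.
  rewrite /word_val big_nil perm1 (_ : fg_of [::] = 1); last exact: val_inj.
  by rewrite mulg1 mulgV; exact: pm_power1.
rewrite word_val_cons -cat1s fg_of_cat; set y := letter_val f a k.
have -> : t k * (fg_of [:: a] * fg_of s) * (t (word_val f s y))^-1 =
   (t k * fg_of [:: a] * (t y)^-1) * (t y * fg_of s * (t (word_val f s y))^-1).
  by rewrite !mulgA mulgVK.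
have {}IHs : pm_power g (t y * fg_of s * (t (word_val f s y))^-1).
  by apply: IHs => e es; apply: tg; rewrite /= inE es orbT.
rewrite gap_step; have [] := tg _ (mem_head _ _) => ->.
  by rewrite invg1 if_same mul1g.
by case: a.2; [exact: pm_power_mulVgl | exact: pm_power_mulgl].
Qed.

(* T is a spanning tree of the walked subgraph: every newly visited vertex
   contributes the edge through which it is first reached. *)
Lemma spanning_tree f k s : exists (t : 'I_n -> free_group m) (T : {set 'I_m * 'I_n}),
  [/\ T \subset eset f k s, #|T|.+1 = #|vset f k s|
    & {in T, forall e, gap f t e = 1}].
Proof.
(* Induction along the walk requires a tree [T] already grown on a set [V] of visited vertices that
   contains the current one. *)
suff: forall (V : {set 'I_n}) (T : {set 'I_m * 'I_n}) (t : 'I_n -> free_group m),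
    k \in V -> #|T|.+1 = #|V| ->
    {in T, forall e, [/\ e.2 \in V, f e.1 e.2 \in V & gap f t e = 1]} ->
    exists (t' : 'I_n -> free_group m) (T' : {set 'I_m * 'I_n}),
      [/\ T' \subset T :|: eset f k s, #|T'|.+1 = #|V :|: vset f k s|
        & {in T', forall e, gap f t' e = 1}].
  move=> /(_ [set k] set0 (fun _ => 1)) [].
  - by rewrite inE.
  - by rewrite cards0 cards1.
  - by move=> e; rewrite inE.
  move=> t [T [sT cT tT]]; exists t, T; split=> //; first by rewrite set0U in sT.
  rewrite cT; congr #|pred_of_set _|; apply/setUidPr.
  by rewrite sub1set inE; case: (s) => *; exact: mem_head.
elim: s k => [|a s IHs] k V T t kV cT tT.
  exists t, T; split; first exact: subsetUl.
    rewrite cT; congr #|pred_of_set _|; apply/esym/setUidPl.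
    by apply/subsetP => x; rewrite !inE => /eqP->.
  by move=> e /tT[].
set y := letter_val f a k; set e0 := step_edge f k a.
have vE : vset f k (a :: s) = k |: vset f y s.
  by apply/setP => x; rewrite !inE.
have eE : eset f k (a :: s) = e0 |: eset f y s.
  by apply/setP => x; rewrite !inE.
have ySv : y \in vset f y s by rewrite inE; case: (s) => *; exact: mem_head.
have [yV | yV] := boolP (y \in V).
  have [t' [T' [sT' cT' tT']]] := IHs y V T t yV cT tT.
  exists t', T'; split=> //; first by rewrite eE setUCA subsetU // sT' orbT.
  rewrite cT' vE setUA; congr #|pred_of_set (_ :|: _)|.
  by apply/esym/setUidPl; rewrite sub1set.
have yk : k != y by apply: contraNneq yV => <-.
(* The new vertex [y] is labelled by the tree path to [k] followed by [a], which makes the gap of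
   [e0] trivial and keeps the gaps of [T]. *)
pose t1 x := if x == y then t k * fg_of [:: a] else t x.
have t1V x : x \in V -> t1 x = t x.
  by rewrite /t1; case: eqP => // -> ; rewrite (negPf yV).
have e0E : (e0.2 == y) || (f e0.1 e0.2 == y).
  rewrite /e0 /step_edge /y /letter_val; case: (a) => i [] /=; rewrite eqxx //.
  by rewrite orbT.
(* The edge [e0] ends at [y], outside [V], whereas the edges of [T] have both ends in [V]. *)
have e0T : e0 \notin T.
  apply/negP => /tT [e1 e2 _]; move: e0E.
  by case/orP => /eqP E; move: yV; rewrite -E ?e1 ?e2.
have e0V : [/\ e0.2 \in y |: V, f e0.1 e0.2 \in y |: V & gap f t1 e0 = 1].
  have ge : gap f t1 e0 = 1.
    have := gap_step f t1 k a; rewrite -/y -/e0 {1 2}/t1 eqxx (negPf yk) mulgV.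
    by case: a.2 => // /esym/eqP; rewrite invg_eq1 => /eqP.
  split=> //; rewrite !inE /e0 /step_edge /y /letter_val; case: (a) => i [] /=.
  - by rewrite eqxx.
  - by rewrite kV orbT.
  - by rewrite permKV kV orbT.
  - by rewrite eqxx.
have [] := IHs y (y |: V) (e0 |: T) t1.
- exact: setU11.
- by rewrite !cardsU1 yV e0T !add1n cT.
- move=> e; rewrite !inE => /predU1P [->|eT]; first by move: e0V; rewrite !inE.
  by have [e1 e2 <-] := tT _ eT; rewrite e1 e2 !orbT /gap !t1V.
move=> t' [T' [sT' cT' tT']]; exists t', T'; split=> //.
  by rewrite eE setUCA setUA.
rewrite cT' vE; congr #|pred_of_set _|; apply/setP => x; rewrite !inE.
have [->|_] := eqVneq x y; first by move: ySv; rewrite inE => ->; rewrite !orbT.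
by have [->|] := eqVneq x k; rewrite ?kV.
Qed.

(** Otherwise at most one edge lies off the spanning tree; its gap generates the fundamental group,
    so the closed walks [u] and [v] are powers of one element. *)
Lemma common_fixpoint_excess f k (u v : free_group m) :
  (forall g, pm_power g u -> pm_power g v -> False) ->
  fg_eval f u k = k -> fg_eval f v k = k ->
  #|vset f k (u ++ v)| < #|eset f k (u ++ v)|.
Proof.
move=> nroot uk vk; rewrite ltnNge; apply/negP => le_ev.
have [t [T [sT cT tT]]] := spanning_tree f k (u ++ v).
have le1 : #|eset f k (u ++ v) :\: T| <= 1.
  by rewrite cardsD (setIidPr sT) leq_subLR addn1 cT.
have [g Hg] : exists g, {in walk_edges f k (u ++ v),
    forall e, gap f t e = 1 \/ gap f t e = g}.
  have [E0|[e0 e0E]] := set_0Vmem (eset f k (u ++ v) :\: T).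
    exists 1 => e eE; left; apply: tT.
    have: e \notin eset f k (u ++ v) :\: T by rewrite E0 inE.
    by rewrite !inE eE andbT negbK.
  exists (gap f t e0) => e eE; have [/tT|eT] := boolP (e \in T); first by left.
  right; congr (gap f t _).
  by apply: (card_le1_eqP le1) => //; rewrite !inE eT.
(* As [w] closes up at [k], the walk gives the conjugate of [w] by the tree word [t k] as a power of
   [g]; conjugating back fixes one root for both words. *)
have conj w : fg_eval f w k = k ->
    {subset walk_edges f k w <= walk_edges f k (u ++ v)} ->
    pm_power ((t k)^-1 * g * t k) w.
  move=> wk sw; have /= := @walk_pm_power f t g k w (fun e ew => Hg e (sw e ew)).
  rewrite -[word_val f w k]/(fg_eval f w k) wk fg_ofK.
  have -> : (t k)^-1 * g * t k = g ^ t k by rewrite conjgE mulgA.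
  have wE : w = (t k * w * (t k)^-1) ^ t k.
    by rewrite conjgE !mulgA mulVg mul1g mulgVK.
  case=> q wq; exists q; rewrite {1 2}wE -conjXg -conjVg.
  by case: wq => ->; [left | right].
apply: (nroot ((t k)^-1 * g * t k)); apply: conj => // e ee;
  rewrite walk_edges_cat mem_cat ?ee //.
(* After [u] the walk is back at [k], so its second half is the walk of [v] from [k]. *)
by rewrite -[word_val f u k]/(fg_eval f u k) uk ee orbT.
Qed.

End Walks.

(** * Union bound, falling factorials and permutations with prescribed values *)

Lemma leq_card_bigcup (I T : finType) (P : pred I) (F : I -> {set T}) :
  #|\bigcup_(i | P i) F i| <= \sum_(i | P i) #|F i|.
Proof.
elim/big_rec2: _ => [|i m A _ le_Am]; first by rewrite cards0.
by rewrite (leq_trans (leq_card_setU _ _)) // leq_add2l.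
Qed.

Lemma ffact_leq_expn n e : n ^_ e <= n ^ e.
Proof.
elim: e => // e IHe.
by rewrite ffactnSr expnSr leq_mul // leq_subr.
Qed.

(** Each factor of the falling factorial is at least [n/2]. *)
Lemma expn_leq_ffact n e : 2 * e <= n -> n ^ e <= 2 ^ e * n ^_ e.
Proof.
elim: e => // e IHe le_en.
have le_en' : 2 * e <= n by apply: leq_trans le_en; rewrite leq_pmul2l.
rewrite expnSr ffactnSr expnSr mulnACA leq_mul ?IHe //.
rewrite mulnBr leq_subRL; last by rewrite (leq_trans le_en') // leq_pmull.
by rewrite [leqRHS]mul2n -addnn leq_add2r.
Qed.

Lemma fact_sub_leq n e : 2 * e <= n -> (n - e)`! * n ^ e <= 2 ^ e * n`!.
Proof.
move=> le_en; have le_e : e <= n by apply: leq_trans le_en; rewrite leq_pmull.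
rewrite -(ffact_fact le_e) mulnA mulnC leq_mul //.
exact: expn_leq_ffact.
Qed.

(** Multiplying by the inverse of [s0] reduces to permutations supported off [A]. *)
Lemma card_perm_agree (T : finType) (s0 : {perm T}) (A : {set T}) :
  #|[set s : {perm T} | [forall x in A, s x == s0 x]]| = (#|T| - #|A|)`!.
Proof.
rewrite -[in RHS](cardsC A) addKn -card_perm -[RHS](card_imset _ (mulIg s0)).
apply: eq_card => s; rewrite inE; apply/forall_inP/imsetP.
  move=> sA; exists (s * s0^-1); last by rewrite mulgVK.
  apply/subsetP => x; rewrite !inE; apply: contraNN => /sA/eqP sx.
  by rewrite permM sx permK.
case=> p /subsetP pA -> x xA; rewrite permM.
suff -> : p x = x by [].
by apply/eqP; apply: contraTT xA => /pA; rewrite inE.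
Qed.

Local Open Scope nat_scope.

(** * Counting generator images whose walk has more edges than vertices *)

Section Counting.
Variables m n : nat.
Implicit Types (f : {ffun 'I_m -> 'S_n}) (k x y : 'I_n) (s : seq (letter m)).

(** The images of the generators are chosen independently, so the count factors over [i], with [A i]
    the points where the [i]-th permutation is prescribed. *)
Lemma card_agree f0 (E : {set 'I_m * 'I_n}) : 2 * #|E| <= n ->
  #|[set f : {ffun 'I_m -> 'S_n} | [forall e in E, f e.1 e.2 == f0 e.1 e.2]]|
    * n ^ #|E| <= 2 ^ #|E| * n`! ^ m.
Proof.
move=> leEn; pose A i := [set y | (i, y) \in E].
have cE : #|E| = \sum_i #|A i|.
  under [RHS]eq_bigr do rewrite -sum1_card.
  rewrite pair_big_dep -sum1_card; apply: eq_bigl => -[i y] /=.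
  by rewrite inE.
have le_A i : #|A i| <= #|E| by rewrite cE (bigD1 i) //= leq_addr.
have -> : #|[set f : {ffun 'I_m -> 'S_n} |
    [forall e in E, f e.1 e.2 == f0 e.1 e.2]]| = \prod_i (n - #|A i|)`!.
  transitivity #|family (fun i => [set s : 'S_n | [forall y in A i, s y == f0 i y]])|.
    apply: eq_card => f; rewrite inE; apply/forall_inP/familyP.
      by move=> fE i; rewrite inE; apply/forall_inP => y; rewrite inE => /fE.
    by move=> fA [i y] iy; have := fA i; rewrite inE => /forall_inP -> //; rewrite inE.
  rewrite card_family foldrE big_map big_enum; apply: eq_bigr => i _ /=.
  by rewrite card_perm_agree card_ord.
have -> : n`! ^ m = \prod_(i < m) n`! by rewrite prod_nat_const card_ord.
rewrite cE !expn_sum -!big_split /=.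
apply: leq_prod => i _; apply: fact_sub_leq.
by apply: leq_trans leEn; rewrite leq_pmul2l.
Qed.

Lemma walk_inj f f' k k' s : walk f k s = walk f' k' s ->
  walk_edges f k s = walk_edges f' k' s /\
  {in walk_edges f k s, forall e, f e.1 e.2 = f' e.1 e.2}.
Proof.
elim: s k k' => [|a s IHs] k k' //= [<- E].
have ak : letter_val f a k = letter_val f' a k by case: (s) E => [|b s'] [].
have [eE fe] := IHs _ _ E; split; first by rewrite eE /step_edge ak.
move=> e; rewrite inE => /predU1P [->|]; last exact: fe.
rewrite /step_edge; case: a ak {E eE fe} => i [] //=; rewrite /letter_val /= => ak.
by rewrite permKV ak permKV.
Qed.

(** For the connected visited subgraph, this says that its fundamental group has rank at least 2. *)
Definition excess f k s := #|vset f k s| < #|eset f k s|.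

(** All [f] counted agree with any one of them, [f0], on its walked edges; excess makes these at
    least one more than the vertices. *)
Lemma card_fixed_walk s (x : seq 'I_n) : 2 * size s <= n ->
  #|[set f | [exists k, (walk f k s == x) && excess f k s]]| * n ^ #|[set y in x]|.+1
    <= 2 ^ size s * n`! ^ m.
Proof.
move=> le_sn; set D := [set f | _].
have [->|[f0]] := set_0Vmem D; first by rewrite cards0.
rewrite inE => /existsP [k0 /andP [/eqP w0 ex0]].
have n_gt0 : 0 < n by apply: leq_ltn_trans (ltn_ord k0).
have le_Es : #|eset f0 k0 s| <= size s.
  rewrite -(size_walk_edges f0 k0 s) cardsE; exact: card_size.
have le_En : 2 * #|eset f0 k0 s| <= n.
  by apply: leq_trans le_sn; rewrite leq_pmul2l.
apply: (@leq_trans (2 ^ #|eset f0 k0 s| * n`! ^ m)); last first.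
  by rewrite leq_mul2r leq_pexp2l ?orbT.
apply: leq_trans (card_agree f0 le_En); apply: leq_mul.
  apply/subset_leq_card/subsetP => f; rewrite !inE => /existsP [k /andP [/eqP wk _]].
  have [eE fE] := walk_inj (etrans wk (esym w0)).
  by apply/forall_inP => e; rewrite inE -eE => /fE ->.
by rewrite leq_pexp2l // -w0.
Qed.

Lemma card_fixed_vset s (S : {set 'I_n}) : 2 * size s <= n ->
  #|[set f | [exists k, (vset f k s == S) && excess f k s]]| * n ^ #|S|.+1
    <= #|S| ^ (size s).+1 * (2 ^ size s * n`! ^ m).
Proof.
move=> le_sn; pose D (w : seq 'I_n) :=
  [set f | [exists k, (walk f k s == w) && excess f k s]].
(* Vertex sequences are encoded as finite functions, so that the union bound runs over a finite
   type. *)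
pose A := [set x : {ffun 'I_(size s).+1 -> 'I_n} |
  (x \in ffun_on S) && ([set y in codom x] == S)].
have cA : #|A| <= #|S| ^ (size s).+1.
  rewrite -[X in _ ^ X]card_ord -card_ffun_on; apply/subset_leq_card/subsetP => x.
  by rewrite inE => /andP[].
have sD : [set f | [exists k, (vset f k s == S) && excess f k s]]
    \subset \bigcup_(x in A) D (codom x).
  apply/subsetP => f; rewrite inE => /existsP [k /andP [/eqP vS ex]].
  pose x := [ffun j : 'I_(size s).+1 => nth k (walk f k s) j].
  have xE : codom x = walk f k s.
    apply: (@eq_from_nth _ k); first by rewrite size_codom card_ord size_walk.
    rewrite size_codom card_ord => i lt_i.
    rewrite codomE (nth_map (Ordinal lt_i)) ?size_enum_ord // ffunE.
    by rewrite nth_enum_ord.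
  apply/bigcupP; exists x; rewrite inE xE.
    rewrite -vS eqxx andbT; apply/ffun_onP => j; rewrite ffunE inE.
    by rewrite mem_nth // size_walk.
  by apply/existsP; exists k; rewrite eqxx.
apply: leq_trans (leq_mul (subset_leq_card sD) (leqnn _)) _.
apply: leq_trans (leq_mul (leq_card_bigcup _ _) (leqnn _)) _.
rewrite big_distrl /=; apply: leq_trans (leq_mul cA (leqnn _)).
rewrite -sum_nat_const; apply: leq_sum => x; rewrite inE => /andP [_ /eqP xS].
by rewrite -{1}xS; exact: card_fixed_walk.
Qed.

(* The first summand covers n < 2 |s|; in the second, |s|+2 counts the possible
   sizes of the vertex set, (|s|+1)^(|s|+1) the walks in a given vertex set, and
   2^|s| comes from n^e <= 2^e n(n-1)...(n-e+1). *)
Definition excess_bound s :=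
  (2 * size s + (size s).+2 * ((size s).+1 ^ (size s).+1 * 2 ^ size s))%N.

Lemma card_excess s : 0 < n ->
  n * #|[set f | [exists k, excess f k s]]| <= excess_bound s * n`! ^ m.
Proof.
move=> n_gt0; rewrite /excess_bound mulnDl.
have [lt_ns|le_sn] := ltnP n (2 * size s).
  apply: leq_trans (leq_addr _ _); apply: leq_mul; first exact: ltnW.
  by apply: leq_trans (max_card _) _; rewrite card_ffun card_ord card_Sn.
apply: leq_trans (leq_addl _ _).
pose L := size s; pose K := ((L.+1 ^ L.+1 * 2 ^ L) * n`! ^ m)%N.
pose D S := [set f | [exists k, (vset f k s == S) && excess f k s]].
have sD : [set f | [exists k, excess f k s]]
    \subset \bigcup_(S : {set 'I_n} | #|S| < L.+2) D S.
  apply/subsetP => f; rewrite inE => /existsP [k ex].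
  apply/bigcupP; exists (vset f k s).
    by rewrite ltnS -(size_walk f k s) cardsE card_size.
  by rewrite inE; apply/existsP; exists k; rewrite eqxx.
apply: leq_trans (leq_mul (leqnn _) (subset_leq_card sD)) _.
apply: leq_trans (leq_mul (leqnn _) (leq_card_bigcup _ _)) _.
rewrite big_distrr /=.
(* The extra edge supplies one more power of [n], which absorbs the factor [n] on the left. *)
apply: (@leq_trans (\sum_(S : {set 'I_n} | #|S| < L.+2) K %/ n ^ #|S|)).
  apply: leq_sum => S cS; rewrite leq_divRL ?expn_gt0 ?n_gt0 //.
  rewrite -mulnA mulnCA -expnS (leq_trans (card_fixed_vset S le_sn)) //.
  by rewrite /K -mulnA leq_mul // leq_exp2r.
(* Group by cardinality [v]; [inord] is faithful in the range summed over. *)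
rewrite (partition_big (fun S : {set 'I_n} => inord #|S|)
  (fun _ : 'I_L.+2 => true)) //=.
rewrite -mulnA -[X in X * _]card_ord -sum_nat_const; apply: leq_sum => v _.
apply: (@leq_trans (\sum_(S in [set S : {set 'I_n} | #|S| == v]) K %/ n ^ v)).
  rewrite [leqLHS](eq_bigl (fun S : {set 'I_n} =>
    S \in [set S : {set 'I_n} | #|S| == v])); last first.
    move=> S; rewrite !inE; apply/andP/eqP => [[lt_S /eqP <-]|->].
      by rewrite inordK.
    by rewrite ltn_ord inord_val.
  by apply: leq_sum => S; rewrite inE => /eqP ->.
(* There are at most [n ^ v] sets of size [v], which cancels the denominator: each size contributes
   at most [K]. *)
rewrite sum_nat_const card_draws card_ord mulnC.
apply: leq_trans (leq_trunc_div K (n ^ v)); rewrite leq_mul //.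
apply: leq_trans (ffact_leq_expn n v); rewrite -bin_ffact.
by rewrite leq_pmulr // fact_gt0.
Qed.

End Counting.

(** * From tangles to the probability bound *)

Lemma porbit_expg_fix (T : finType) (s : {perm T}) x :
  (s ^+ #|porbit s x|)%g x = x.
Proof. by rewrite permX iter_porbit. Qed.

(** The exponents are the orbit sizes at [k]: positive, below [N], and such that both powers fix
    [k]. *)
Lemma tangled_excess (K : realType) (R : K) (m n N : nat) (w1 w2 : free_group m)
    (phi : HomFS m n) : distinct_powers w1 w2 -> (R < N%:R)%R ->
  tangled R w1 w2 phi ->
  exists (a b : 'I_N) (k : 'I_n),
    excess (gens_of phi) k ((w1 ^+ a)%g ++ (w2 ^+ b)%g).
Proof.
move=> dw ltRN /existsP [k leR].
have ltN : #|porbit (phi w1) k| + #|porbit (phi w2) k| < N.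
  by rewrite -(ltr_nat K) (le_lt_trans leR).
have porbit_gt0 (s : 'S_n) : 0 < #|porbit s k|.
  by apply/card_gt0P; exists k; exact: porbit_id.
exists (Ordinal (leq_ltn_trans (leq_addr _ _) ltN)).
exists (Ordinal (leq_ltn_trans (leq_addl _ _) ltN)); exists k.
apply: common_fixpoint_excess => /= [g||].
- exact: distinct_powers_no_root.
- by rewrite fg_evalE gmulfXn porbit_expg_fix.
- by rewrite fg_evalE gmulfXn porbit_expg_fix.
Qed.

(** Union bound over the pairs of exponents, with homomorphisms counted through their generator
    images. *)
Lemma card_tangled (K : realType) (R : K) (m n N : nat) (w1 w2 : free_group m) :
  distinct_powers w1 w2 -> (R < N%:R)%R -> 0 < n ->
  n * #|[set phi : HomFS m n | tangled R w1 w2 phi]| <=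
  (\sum_(ab : 'I_N * 'I_N) excess_bound ((w1 ^+ ab.1)%g ++ (w2 ^+ ab.2)%g))
    * n`! ^ m.
Proof.
move=> dw ltRN n_gt0; rewrite -(card_imset _ (can_inj (@gens_ofK m n))).
pose D (ab : 'I_N * 'I_N) := [set f : {ffun 'I_m -> 'S_n} |
  [exists k, excess f k ((w1 ^+ ab.1)%g ++ (w2 ^+ ab.2)%g)]].
rewrite big_distrl /=; apply: (@leq_trans (\sum_ab n * #|D ab|)); last first.
  by apply: leq_sum => ab _; exact: card_excess.
rewrite -big_distrr leq_mul //.
apply: leq_trans (leq_card_bigcup _ _); apply/subset_leq_card/subsetP => f.
case/imsetP => phi; rewrite inE => /(tangled_excess dw ltRN) [a [b [k ex]]] ->.
by apply/bigcupP; exists (a, b) => //; rewrite inE; apply/existsP; exists k.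
Qed.

Local Open Scope ring_scope.

Theorem theorem1p7 (K : realType) (m : nat) (m_ge1 : (1 <= m)%N)
    (w1 w2 : free_group m) (w1w2 : distinct_powers w1 w2)
    (R : K) (R_gt0 : 0 < R) :
  exists C : K, forall n : nat, (1 <= n)%N ->
    #|[set phi : HomFS m n | tangled R w1 w2 phi]|%:R / #|{: HomFS m n}|%:R
      <= C / n%:R.
Proof.
(* A natural number above [R] bounds the exponents, so the constant below is independent of [n]. *)
pose N := Num.bound R; have ltRN : R < N%:R by exact/archi_boundP/ltW.
exists (\sum_(ab : 'I_N * 'I_N)
  excess_bound ((w1 ^+ ab.1)%g ++ (w2 ^+ ab.2)%g))%N%:R => n n_gt0.
have := card_tangled w1w2 ltRN n_gt0; rewrite card_HomFS.
rewrite ler_pdivrMr ?ltr0n ?expn_gt0 ?fact_gt0 //.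
rewrite mulrAC ler_pdivlMr ?ltr0n //.
by rewrite -!natrM ler_nat mulnC.
Qed.
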